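(* Let $0 < \alpha < 1$ and let $s'_i(\alpha)$, $i \ge 1$, be defined from the differential equations in the context. Then there exist constants $c_1 > 0$, $c_3 > 0$ and $0 < c_2 < 1$, which may depend on $\alpha$, such that for all sufficiently large integers $i$, $$s'_i(\alpha) \le c_1\, c_2^{\,2^{\,i-c_3}}.$$
   Context: This is the asymptotic (infinite-table) model of Robin Hood hashing with insertions only, in which $s'_i(\beta)$ represents the fraction of cells containing keys of age at least $i$ at load $\beta$. Concretely, define functions $s_i(t)$, $t \ge 0$, $i \ge 1$, by $s_i(0)=0$ for all $i$ and $$\frac{ds_i}{dt} = (1-s_i)\prod_{j=1}^{i-1} s_j \quad (i \ge 1),$$ (the empty product being 1, so $ds_1/dt = 1-s_1$ and $s_1(t)=1-e^{-t}$). For a load $\beta \in [0,1)$ set $s'_i(\beta) = s_i(-\ln(1-\beta))$. *)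

(* Defs.v *)
From Stdlib Require Import Reals List.
Open Scope R_scope.

(** The product of [s j t] over [1 <= j <= i - 1]; it is [1] for [i = 1]. *)
Definition prod_below (s : nat -> R -> R) (i : nat) (t : R) : R :=
  fold_right Rmult 1 (map (fun j => s j t) (seq 1 (i - 1))).

(** [D_in] is the derivative relative to the domain [[0, +oo)], so it is
    one-sided at [0].  The indices start at [1] and time at [0]: [s 0] and the
    values [s i t] for [t < 0] are unconstrained. *)
Definition age_equations (s : nat -> R -> R) : Prop :=
  forall i : nat, (1 <= i)%nat ->
    s i 0 = 0 /\
    forall t : R, 0 <= t ->
      D_in (s i) (fun u => (1 - s i u) * prod_below s i u) (fun u => 0 <= u) t.

(** For a load [beta] in [[0, 1)], the fraction of cells containing keys of
    age at least [i]. *)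
Definition at_load (s : nat -> R -> R) (i : nat) (beta : R) : R :=
  s i (- ln (1 - beta)).

(* Main.v *)
(** Put [x_1 = t] and [x_(i+1) = x_i - 1 + exp (- x_i)].  If [s_j = 1 - exp (- x_j)]
    for all [j < i], then [dx_i/dt] is the product of the [s_j] with [j < i], so
    [(1 - s_i) exp x_i] has derivative [0] and equals [1]; hence
    [s_i = 1 - exp (- x_i) <= x_i] for every [i].  For fixed [t], [1 + x <= exp x]
    gives [x_(i+1) <= x_i^2 / (1 + x_i)].  So [x_i] drops by at least [1/3] as long
    as it exceeds [1/2], and from then on it is at least squared at each step. *)

Require Import Defs.
From Stdlib Require Import Reals List.
From Stdlib Require Import Arith Lra Lia.
Open Scope R_scope.

Lemma derivable_pt_lim_D_in_domain (f d : R -> R) (D : R -> Prop) (x : R) :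
  derivable_pt_lim f x (d x) -> D_in f d D x.
Proof.
  intros H eps Heps.
  destruct (H eps Heps) as [delta Hd].
  exists delta; split; [apply cond_pos|].
  intros y [[_ Hyx] Hdist].
  simpl in *; unfold Rdist in *.
  specialize (Hd (y - x)).
  replace (x + (y - x)) with y in Hd by ring.
  apply Hd; [lra | exact Hdist].
Qed.

Lemma D_in_ext (f d1 d2 : R -> R) (D : R -> Prop) (x : R) :
  d1 x = d2 x -> D_in f d1 D x -> D_in f d2 D x.
Proof. unfold D_in; intros ->; trivial. Qed.

Lemma null_D_in_constant (f : R -> R) :
  (forall t, 0 <= t -> D_in f (fun _ => 0) (fun u => 0 <= u) t) ->
  forall t, 0 <= t -> f t = f 0.
Proof.
  intros H t Ht.
  (* Freezing [f] at its value in [0] on the negative axis gives a two-sided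
     derivative everywhere. *)
  set (g := fun u => f (Rmax 0 u)).
  assert (Hg : forall u, derivable_pt_lim g u 0).
  { intros u eps Heps.
    assert (Hneg : forall h, u + h <= 0 -> u <= 0 ->
              Rabs ((g (u + h) - g u) / h - 0) < eps).
    { intros h Huh Hu; unfold g; rewrite !Rmax_left by assumption.
      replace ((f 0 - f 0) / h - 0) with 0 by (unfold Rdiv; ring).
      now rewrite Rabs_R0. }
    destruct (Rlt_or_le u 0) as [Hu|Hu].
    - assert (Hd : 0 < - u) by lra.
      exists (mkposreal _ Hd); intros h _ Hh; simpl in Hh.
      apply Rabs_def2 in Hh.
      apply Hneg; lra.
    - destruct (H u Hu eps Heps) as [delta [Hdelta Hd]].
      simpl in Hd; unfold Rdist, D_x in Hd.
      assert (Hpos : forall h, h <> 0 -> Rabs h < delta -> 0 <= u + h ->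
                Rabs ((g (u + h) - g u) / h - 0) < eps).
      { intros h Hh0 Hh Huh; unfold g; rewrite !Rmax_right by assumption.
        specialize (Hd (u + h)).
        replace (u + h - u) with h in Hd by ring.
        apply Hd; repeat split; trivial; lra. }
      (* At [0] increments of both signs occur; for [u > 0] the radius [Rmin delta u] keeps [u + h]
         in the domain. *)
      destruct (Req_dec u 0) as [Hu0|Hu0].
      + exists (mkposreal _ Hdelta); intros h Hh0 Hh; simpl in Hh.
        destruct (Rle_or_lt 0 (u + h)); [now apply Hpos | apply Hneg; lra].
      + assert (Hm : 0 < Rmin delta u) by (apply Rmin_glb_lt; lra).
        exists (mkposreal _ Hm); intros h Hh0 Hh; simpl in Hh.
        pose proof (Rmin_l delta u); pose proof (Rmin_r delta u).
        apply Hpos; trivial; [lra|].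
        apply Rabs_def2 in Hh; lra. }
  set (pr := (fun u => exist _ 0 (Hg u)) : derivable g).
  assert (Hc : constant g).
  { apply (null_derivative_1 g pr); reflexivity. }
  specialize (Hc t 0); unfold g in Hc.
  rewrite (Rmax_right 0 t), (Rmax_right 0 0) in Hc; trivial; lra.
Qed.

Lemma prod_below_S (s : nat -> R -> R) (n : nat) (t : R) :
  prod_below s (S (S n)) t = prod_below s (S n) t * s (S n) t.
Proof.
  unfold prod_below.
  replace (S (S n) - 1)%nat with (S n) by lia.
  replace (S n - 1)%nat with n by lia.
  rewrite seq_S, map_app, fold_right_app; simpl.
  rewrite Rmult_1_r.
  generalize (s (S n) t) as a; intro a.
  (* The top factor sits in the initial value of the fold; induction on the list moves it
     outside. *)
  induction (map _ _) as [|b l IH]; simpl; [ring | rewrite IH; ring].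
Qed.

(* [age_exponent n] is [x_(n+1)] in the notation above. *)
Fixpoint age_exponent (n : nat) (t : R) : R :=
  match n with
  | O => t
  | S m => age_exponent m t - 1 + exp (- age_exponent m t)
  end.

Lemma age_exponent_0 (n : nat) : age_exponent n 0 = 0.
Proof.
  induction n as [|n IH]; simpl; trivial.
  rewrite IH, Ropp_0, exp_0; ring.
Qed.

(** Since [x - 1 + exp (- x)] has derivative [x' * (1 - exp (- x))], each step of the recursion
    contributes one more factor [s_j]. Only indices below [n] are assumed solved, which suits strong
    induction. *)
Lemma derivable_pt_lim_age_exponent (s : nat -> R -> R) (n : nat) (t : R) :
  (forall k, (k < n)%nat -> s (S k) t = 1 - exp (- age_exponent k t)) ->
  derivable_pt_lim (age_exponent n) t (prod_below s (S n) t).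
Proof.
  induction n as [|n IH]; intros Hs.
  - apply derivable_pt_lim_id.
  - assert (Hn : derivable_pt_lim (age_exponent n) t (prod_below s (S n) t)).
    { apply IH; intros k Hk; apply Hs; lia. }
    rewrite prod_below_S, (Hs n) by lia.
    set (p := prod_below s (S n) t) in *.
    replace (p * (1 - exp (- age_exponent n t)))
      with ((p - 0) + exp (- age_exponent n t) * - p) by ring.
    apply (derivable_pt_lim_plus (fun u => age_exponent n u - 1)
             (fun u => exp (- age_exponent n u))).
    + apply (derivable_pt_lim_minus (age_exponent n) (fun _ => 1)); trivial.
      apply derivable_pt_lim_const.
    + apply (derivable_pt_lim_comp (fun u => - age_exponent n u) exp).
      * now apply (derivable_pt_lim_opp (age_exponent n)).
      * apply derivable_pt_lim_exp.
Qed.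

Lemma age_equations_solution (s : nat -> R -> R) :
  age_equations s -> forall n t, 0 <= t ->
  s (S n) t = 1 - exp (- age_exponent n t).
Proof.
  intros hs n; induction n as [n IH] using lt_wf_ind; intros t Ht.
  destruct (hs (S n)) as [Hs0 Hs]; [lia|].
  set (u := fun r => (1 - s (S n) r) * exp (age_exponent n r)).
  assert (Hu : u t = u 0).
  { apply null_D_in_constant; trivial.
    intros r Hr; unfold u.
    pose (p := prod_below s (S n)).
    (* The two terms of the product rule cancel. *)
    eapply D_in_ext;
      [| apply (Dmult _
           (fun r => 0 - (1 - s (S n) r) * p r)
           (fun r => exp (age_exponent n r) * p r)
           (fun r => 1 - s (S n) r) (fun r => exp (age_exponent n r)))].
    - simpl; ring.
    - apply (Dminus _ (fun _ => 0) (fun r => (1 - s (S n) r) * p r)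
               (fun _ => 1) (s (S n))); [apply Dconst | now apply Hs].
    - apply derivable_pt_lim_D_in_domain.
      apply (derivable_pt_lim_comp (age_exponent n) exp).
      + apply derivable_pt_lim_age_exponent.
        intros k Hk; now apply IH.
      + apply derivable_pt_lim_exp. }
  unfold u in Hu; rewrite Hs0, age_exponent_0, exp_0 in Hu.
  rewrite exp_Ropp.
  pose proof (exp_pos (age_exponent n t)) as He.
  replace (/ exp (age_exponent n t)) with (1 - s (S n) t); [ring|].
  apply (Rmult_eq_reg_r (exp (age_exponent n t))); [|lra].
  rewrite Hu, Rinv_l; lra.
Qed.

Lemma age_exponent_nonneg (n : nat) (t : R) : 0 <= t -> 0 <= age_exponent n t.
Proof.
  intros Ht; destruct n as [|n]; simpl; trivial.
  pose proof (exp_ineq1_le (- age_exponent n t)); lra.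
Qed.

Lemma age_exponent_step (n : nat) (t : R) : 0 <= t ->
  age_exponent (S n) t * (1 + age_exponent n t) <= age_exponent n t ^ 2.
Proof.
  intros Ht; simpl age_exponent.
  pose proof (age_exponent_nonneg n t Ht) as Hx.
  set (x := age_exponent n t) in *.
  pose proof (exp_ineq1_le x) as He.
  pose proof (exp_pos (- x)) as Hp.
  assert (Hinv : exp (- x) * exp x = 1) by (rewrite <- exp_plus, Rplus_opp_l; apply exp_0).
  (* [(x - 1) (1 + x) + exp (- x) (1 + x) <= x^2 - 1 + exp (- x) exp x = x^2]. *)
  nra.
Qed.

(** The descent rate comes from [x^2 / (1 + x) = x - x / (1 + x)], where [x / (1 + x) > 1/3] for
    [x > 1/2]. The maximum in the invariant also covers the stage after [1/2] is reached, since the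
    sequence never increases. *)
Lemma age_exponent_eventually_le_half (t : R) : 0 <= t ->
  exists M, age_exponent M t <= / 2.
Proof.
  intros Ht.
  assert (H : forall n, age_exponent n t <= Rmax (/ 2) (t - INR n / 3)).
  { induction n as [|n IH].
    - simpl; apply Rle_trans with (2 := Rmax_r _ _); lra.
    - rewrite S_INR.
      pose proof (age_exponent_step n t Ht) as Hs.
      pose proof (age_exponent_nonneg n t Ht) as H0.
      destruct (Rle_or_lt (age_exponent n t) (/ 2)) as [Hx|Hx].
      + apply Rle_trans with (2 := Rmax_l _ _); nra.
      + apply Rle_trans with (2 := Rmax_r _ _).
        assert (age_exponent n t <= t - INR n / 3).
        { destruct (Rmax_Rle (/ 2) (t - INR n / 3) (age_exponent n t)) as [Hm _].
          destruct (Hm IH); lra. }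
        nra. }
  destruct (INR_unbounded (3 * t)) as [M HM].
  exists M; apply Rle_trans with (1 := H M).
  apply Rmax_lub; lra.
Qed.

Lemma age_exponent_doubly_exponential (M k : nat) (t : R) : 0 <= t ->
  age_exponent M t <= / 2 ->
  age_exponent (M + k) t <= Rpower (/ 2) (2 ^ k).
Proof.
  intros Ht HM; induction k as [|k IH].
  - simpl; rewrite Nat.add_0_r, Rpower_1; lra.
  - rewrite Nat.add_succ_r; simpl pow.
    replace (2 * 2 ^ k) with (2 ^ k + 2 ^ k) by ring.
    rewrite Rpower_plus.
    pose proof (age_exponent_step (M + k) t Ht).
    pose proof (age_exponent_nonneg (M + k) t Ht).
    pose proof (age_exponent_nonneg (S (M + k)) t Ht).
    apply Rle_trans with (age_exponent (M + k) t * age_exponent (M + k) t); nra.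
Qed.

Theorem theorem4 (s : nat -> R -> R) (hs : age_equations s)
    (alpha : R) (halpha : 0 < alpha < 1) :
  exists c1 c2 c3 : R,
    0 < c1 /\ 0 < c2 < 1 /\ 0 < c3 /\
    exists N : nat, forall i : nat, (N <= i)%nat ->
      at_load s i alpha <= c1 * Rpower c2 (Rpower 2 (INR i - c3)).
Proof.
  unfold at_load; set (t := - ln (1 - alpha)).
  assert (Ht : 0 <= t).
  { assert (ln (1 - alpha) < ln 1) by (apply ln_increasing; lra).
    rewrite ln_1 in *; unfold t; lra. }
  destruct (age_exponent_eventually_le_half t Ht) as [M HM].
  (* [c2] is the threshold at which squaring takes over. [c3] is [M + 1], not [M], because [s_i]
     goes with [age_exponent (i - 1)]. *)
  exists 1, (/ 2), (INR (S M)).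
  repeat split; try lra.
  { apply lt_0_INR; lia. }
  exists (S M); intros i Hi.
  replace i with (S (M + (i - S M)))%nat by lia.
  set (k := (i - S M)%nat).
  rewrite (age_equations_solution s hs) by trivial.
  replace (INR (S (M + k)) - INR (S M)) with (INR k)
    by (rewrite !S_INR, plus_INR; ring).
  rewrite Rpower_pow, Rmult_1_l by lra.
  (* This gives [1 - exp (- x) <= x], hence [c1 = 1]. *)
  pose proof (exp_ineq1_le (- age_exponent (M + k) t)).
  pose proof (age_exponent_doubly_exponential M k t Ht HM).
  lra.
Qed.
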